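(* There is an algorithm that, given a 1.5D terrain $T$ with $n$ vertices, computes the prickliness $\pi(T)$ in $O(n\log n)$ time.
   Context: A 1.5D terrain $T$ is an $x$-monotone polygonal line in $\mathbb{R}^2$, given by its sequence of vertices; two vertices are neighbors if they are joined by an edge. A vertex is internal if it is not an endpoint of the polygonal line. A vertex $v$ is convex if there is a non-vertical line through $v$ that leaves all neighboring points of $v$ on $T$ below it. For a vector $\vec w\in\mathbb{R}^2$, a vertex $v$ is a local maximum of $T$ in direction $\vec w$ if $\langle v,\vec w\rangle > \langle u,\vec w\rangle$ for every neighbor $u$ of $v$. Let $\pi_{\vec w}(T)$ be the number of internal and convex vertices of $T$ that are local maxima of $T$ in direction $\vec w$. The prickliness of $T$ is $\pi(T)=\max_{\vec w}\pi_{\vec w}(T)$ (equivalently, the maximum over all invertible affine transformations $A$ of the plane of the number of internal and convex vertices of $T$ that are local maxima, in the vertical direction, of $A(T)$). Running time is measured in the standard real-RAM model of computational geometry (unit-cost arithmetic operations and comparisons on real numbers). *)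

(* Defs.v *)
From HB Require Import structures.
From mathcomp Require Import all_boot all_order all_algebra.
From mathcomp Require Import all_classical all_reals all_analysis.

Set Implicit Arguments.
Unset Strict Implicit.
Unset Printing Implicit Defensive.

Import Order.TTheory GRing.Theory Num.Theory.
Import numFieldNormedType.Exports.
Local Open Scope ring_scope.

(** * Terrains and prickliness *)

Section Prickliness.
Variables (R : realType) (n : nat).
Implicit Types (T : n.-tuple (R * R)) (w : R * R) (i j : 'I_n).

(** Vertices are listed from left to right. *)
Definition terrain T : Prop :=
  forall i j, (i < j)%N -> (tnth T i).1 < (tnth T j).1.

Definition neighbor i j : bool := (i.+1 == j)%N || (j.+1 == i)%N.

Definition internal i : bool := (0 < i)%N && (i.+1 < n)%N.

(** The non-vertical line is [y = a * x + b]. *)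
Definition convex_vertex T i : Prop :=
  exists a b : R,
    (tnth T i).2 = a * (tnth T i).1 + b /\
    forall j, neighbor i j -> (tnth T j).2 < a * (tnth T j).1 + b.

Definition dot (p w : R * R) : R := p.1 * w.1 + p.2 * w.2.

Definition local_max T w i : bool :=
  [forall j, neighbor i j ==> (dot (tnth T j) w < dot (tnth T i) w)].

Definition prickliness_dir T w : nat :=
  #|[set i | [&& internal i, `[< convex_vertex T i >] & local_max T w i]]|.

(** Since [prickliness_dir T w <= n], the maximum over the infinitely many
    directions is the largest [k <= n] that is attained. *)
Definition prickliness T : nat :=
  \max_(k < n.+1 | `[< exists w, prickliness_dir T w = k >]) k.

Lemma prickliness_dir_le T w : (prickliness_dir T w <= prickliness T)%N.
Proof.
have lt_n : (prickliness_dir T w < n.+1)%N.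
  by rewrite ltnS -[leqRHS]card_ord max_card.
rewrite /prickliness.
have /= := @leq_bigmax_cond _ _ (fun k : 'I_n.+1 => k : nat) (Ordinal lt_n).
by apply; apply/asboolP; exists w.
Qed.

Lemma prickliness_attained T : exists w, prickliness_dir T w = prickliness T.
Proof.
have lt_n : (prickliness_dir T (0%R, 0%R) < n.+1)%N.
  by rewrite ltnS -[leqRHS]card_ord max_card.
rewrite /prickliness.
rewrite (bigop.bigmax_eq_arg (Ordinal lt_n)); last by apply/asboolP; exists (0, 0)%R.
case: arg_maxnP => [|k /asboolP[w wk] _]; first by apply/asboolP; exists (0, 0)%R.
by exists w.
Qed.

End Prickliness.

(** * The real RAM

    The machine has integer registers and an integer memory (holding natural
    numbers, used for indices and counters), and real registers and a real
    memory.  Registers are addressed by constants of the program; memory cells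
    are addressed indirectly, through an integer register.  Every instruction
    costs one time unit.  There is no rounding, no conversion between reals and
    integers, and integers are only added, subtracted and compared, so that the
    unit-cost assumption cannot be abused.  Real constants are integers. *)

Variant arith_op := OpAdd | OpSub | OpMul | OpDiv.

(** In the comments, [I], [F] are the integer and real registers, and
    [MI], [MF] the integer and real memories. *)
Variant instr :=
| IConst (d c : nat)                      (* I[d] := c *)
| IAdd (d a b : nat)                      (* I[d] := I[a] + I[b] *)
| ISub (d a b : nat)                      (* I[d] := max(I[a] - I[b], 0) *)
| ILoad (d a : nat)                       (* I[d] := MI[I[a]] *)
| IStore (a s : nat)                      (* MI[I[a]] := I[s] *)
| FConst (d : nat) (c : int)              (* F[d] := c *)
| FArith (op : arith_op) (d a b : nat)    (* F[d] := F[a] op F[b] *)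
| FLoad (d a : nat)                       (* F[d] := MF[I[a]] *)
| FStore (a s : nat)                      (* MF[I[a]] := F[s] *)
| Jump (l : nat)                          (* goto l *)
| JumpILt (a b l : nat)                   (* if I[a] < I[b] then goto l *)
| JumpFLt (a b l : nat)                   (* if F[a] < F[b] then goto l *)
| Halt.

Definition program := seq instr.

Section RealRAM.
Variable R : realType.

Record state := State {
  pc : nat;
  ireg : nat -> nat;
  freg : nat -> R;
  imem : nat -> nat;
  fmem : nat -> R
}.

Definition upd (A : Type) (f : nat -> A) (k : nat) (v : A) : nat -> A :=
  fun l => if l == k then v else f l.

Definition set_ireg s d v :=
  State (pc s).+1 (upd (ireg s) d v) (freg s) (imem s) (fmem s).
Definition set_freg s d v :=
  State (pc s).+1 (ireg s) (upd (freg s) d v) (imem s) (fmem s).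
Definition set_imem s a v :=
  State (pc s).+1 (ireg s) (freg s) (upd (imem s) a v) (fmem s).
Definition set_fmem s a v :=
  State (pc s).+1 (ireg s) (freg s) (imem s) (upd (fmem s) a v).
Definition goto s l := State l (ireg s) (freg s) (imem s) (fmem s).

(** Division by zero is undefined. *)
Definition eval_op (op : arith_op) (x y : R) : option R :=
  match op with
  | OpAdd => Some (x + y)
  | OpSub => Some (x - y)
  | OpMul => Some (x * y)
  | OpDiv => if y == 0 then None else Some (x / y)
  end.

(** [None] means that the machine cannot take a further step. *)
Definition step (ins : instr) (s : state) : option state :=
  match ins with
  | IConst d c => Some (set_ireg s d c)
  | IAdd d a b => Some (set_ireg s d (ireg s a + ireg s b)%N)
  | ISub d a b => Some (set_ireg s d (ireg s a - ireg s b)%N)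
  | ILoad d a => Some (set_ireg s d (imem s (ireg s a)))
  | IStore a k => Some (set_imem s (ireg s a) (ireg s k))
  | FConst d c => Some (set_freg s d c%:~R)
  | FArith op d a b => omap (set_freg s d) (eval_op op (freg s a) (freg s b))
  | FLoad d a => Some (set_freg s d (fmem s (ireg s a)))
  | FStore a k => Some (set_fmem s (ireg s a) (freg s k))
  | Jump l => Some (goto s l)
  | JumpILt a b l =>
      Some (goto s (if (ireg s a < ireg s b)%N then l else (pc s).+1))
  | JumpFLt a b l =>
      Some (goto s (if freg s a < freg s b then l else (pc s).+1))
  | Halt => None
  end.

(** Running off the end of the program also halts. *)
Definition current (P : program) (s : state) : instr := nth Halt P (pc s).

Fixpoint steps (P : program) (t : nat) (s : state) : option state :=
  if t is t'.+1 then obind (steps P t') (step (current P s) s) else Some s.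

Definition halts_in (P : program) (s : state) (t : nat) (s' : state) : Prop :=
  steps P t s = Some s' /\ current P s' = Halt.

(** The number of vertices is in integer register 0; the coordinates of vertex
    [i] are in the real memory cells [2 * i] and [2 * i + 1]; everything else
    is zero. *)
Definition input (n : nat) (T : n.-tuple (R * R)) : state :=
  State 0
    (fun r => if r == 0%N then n else 0%N)
    (fun=> 0)
    (fun=> 0%N)
    (fun a => let p := nth (0, 0) T a./2 in if odd a then p.2 else p.1).

Definition output (s : state) : nat := ireg s 0.

End RealRAM.

(* Main.v *)
(** A vertex [i] is convex and a local maximum in direction [w] exactly when
    [w] points upwards and [m = - w.1 / w.2] satisfies
    [slope i < m < slope i.-1], so the prickliness is the maximal depth of a
    family of open intervals.  This equals the maximal depth of the half-open
    intervals [[slope i, slope i.-1[], which is found by sorting the endpoints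
    and, at each gap between two consecutive distinct endpoints, subtracting
    the number of closing endpoints seen so far from the number of opening
    ones.

    The endpoints are sorted bottom-up in fresh memory.  Their number is
    rounded up to a power of two [N]; the missing ones are the cells that are
    still [(0, 0)], which count neither as opening nor as closing. *)

Require Import Defs.
From HB Require Import structures.
From mathcomp Require Import all_boot all_order all_algebra.
From mathcomp Require Import all_classical all_reals all_analysis.
From mathcomp Require Import zify ring lra.

Set Implicit Arguments.
Unset Strict Implicit.
Unset Printing Implicit Defensive.

Import Order.TTheory GRing.Theory Num.Theory.
Import numFieldNormedType.Exports.
Local Open Scope classical_set_scope.
Local Open Scope ring_scope.

(** * Structured programs and timed total correctness *)

Variant test := TestI (a b : nat) | TestF (a b : nat).

Inductive cmd :=
| Block of seq instr
| Seq of cmd & cmd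
| If of test & cmd & cmd
| While of test & cmd.

Definition jump_if (b : test) (l : nat) : instr :=
  match b with TestI x y => JumpILt x y l | TestF x y => JumpFLt x y l end.

(** Jump targets are absolute, hence the argument [base]. The machine jumps only when a test
    succeeds, so the else branch is laid out first, and a loop starts with two instructions: a jump
    into the body and a jump past it. *)
Fixpoint compile (base : nat) (c : cmd) : program :=
  match c with
  | Block code => code
  | Seq c1 c2 =>
      let p1 := compile base c1 in p1 ++ compile (base + size p1) c2
  | If b c1 c2 =>
      let p2 := compile base.+1 c2 in
      let l := (base.+1 + size p2).+1 in
      let p1 := compile l c1 in
      jump_if b l :: p2 ++ Jump (l + size p1) :: p1
  | While b c =>
      let p := compile base.+2 c in
      [:: jump_if b base.+2, Jump (base.+2 + size p).+1 & p ++ [:: Jump base]]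
  end%N.

Definition code_at (P : program) (base : nat) (p : program) : Prop :=
  forall i, (i < size p)%N -> nth Halt P (base + i) = nth Halt p i.

Lemma code_at_cat P base p1 p2 : code_at P base (p1 ++ p2) ->
  code_at P base p1 /\ code_at P (base + size p1) p2.
Proof.
move=> H; split=> i lti.
  by rewrite H ?nth_cat ?lti // size_cat ltn_addr.
by rewrite -addnA H ?size_cat ?ltn_add2l // nth_cat ltnNge leq_addr /= addKn.
Qed.

Lemma code_at_cons P base ins p : code_at P base (ins :: p) ->
  nth Halt P base = ins /\ code_at P base.+1 p.
Proof.
move=> H; split; first by have := H 0%N isT; rewrite addn0.
by move=> i lti; rewrite addSnnS H.
Qed.

(** * Timed Hoare triples for compiled commands *)

Section Triples.
Variable R : realType.
Implicit Types (s : state R) (Q : state R -> Prop) (c : cmd) (P : program).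

Definition holds (b : test) s : bool :=
  match b with
  | TestI x y => (ireg s x < ireg s y)%N
  | TestF x y => freg s x < freg s y
  end.

Definition straight (ins : instr) : bool :=
  match ins with
  | Jump _ | JumpILt _ _ _ | JumpFLt _ _ _ | Halt => false
  | _ => true
  end.

(** Symbolic execution of straight-line code, so that a block is verified by computing its final
    state. The result is [None] on a jump, on [Halt] or on a division by zero. *)
Fixpoint run_block (code : seq instr) s : option (state R) :=
  if code is ins :: code' then
    if straight ins then obind (run_block code') (step ins s) else None
  else Some s.

(** The program counters of [s] and of the final state are irrelevant. *)
Definition triple c s (T : nat) Q : Prop :=
  forall P base, code_at P base (compile base c) ->
  exists t s', [/\ steps P t (goto s base)
                     = Some (goto s' (base + size (compile base c))),
                   (t <= T)%N & Q s'].

Lemma steps_add P t1 t2 s s' : steps P t1 s = Some s' ->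
  steps P (t1 + t2) s = steps P t2 s'.
Proof.
elim: t1 s => [|t1 IH] s /=; first by case=> ->.
by case: step => //= s1; apply: IH.
Qed.

Lemma steps_trans P t1 t2 s1 s2 s3 : steps P t1 s1 = Some s2 ->
  steps P t2 s2 = Some s3 -> steps P (t1 + t2) s1 = Some s3.
Proof. by move=> /steps_add->. Qed.

Lemma steps_jump P s base l : nth Halt P base = Jump l ->
  steps P 1 (goto s base) = Some (goto s l).
Proof. by move=> H; rewrite /= /current /= H. Qed.

Lemma steps_jump_if P s base b l : nth Halt P base = jump_if b l ->
  steps P 1 (goto s base) = Some (goto s (if holds b s then l else base.+1)).
Proof. by move=> H; rewrite /= /current /= H; case: b {H}. Qed.

Lemma step_straight ins s s' base : straight ins -> step ins s = Some s' ->
  step ins (goto s base) = Some (goto s' base.+1).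
Proof.
case: ins => //=; try by move=> *; match goal with H : Some _ = Some _ |- _ =>
  case: H => <- end.
move=> op d x y _; case: eval_op => //= v.
by case=> <-.
Qed.

Lemma triple_block code s s' Q : run_block code s = Some s' -> Q s' ->
  triple (Block code) s (size code) Q.
Proof.
move=> + Qs' P base /=; elim: code s base => [|ins code IH] s base /=.
  by case=> -> _; exists 0%N, s'; rewrite addn0.
case: ifP => // str; case E: (step ins s) => [s1|] //= run.
case/code_at_cons=> Pb /(IH _ _ run)[t [s2 [st tle Q2]]].
exists t.+1, s2; split=> //; rewrite -addSnnS -st /= /current /= Pb.
by rewrite (step_straight _ str E).
Qed.

Lemma triple_weaken c s T1 T2 Q1 Q2 : triple c s T1 Q1 -> (T1 <= T2)%N ->
  (forall s', Q1 s' -> Q2 s') -> triple c s T2 Q2.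
Proof.
move=> H le12 Q12 P base /H[t [s' [st le Qs']]].
by exists t, s'; split=> //; [exact: leq_trans le12|exact: Q12].
Qed.

Lemma triple_seq c1 c2 s T1 T2 Q1 Q2 : triple c1 s T1 Q1 ->
  (forall s', Q1 s' -> triple c2 s' T2 Q2) ->
  triple (Seq c1 c2) s (T1 + T2) Q2.
Proof.
move=> H1 H2 P base /= /code_at_cat[/H1[t1 [s1 [st1 le1 Q1s]]]].
move=> /(H2 _ Q1s)[t2 [s2 [st2 le2 Q2s]]].
exists (t1 + t2)%N, s2; split=> //; last exact: leq_add.
by rewrite size_cat addnA; apply: steps_trans st1 st2.
Qed.

(** The two extra steps are the test and the jump that closes the else branch. *)
Lemma triple_if b c1 c2 s T Q :
  (holds b s -> triple c1 s T Q) -> (~~ holds b s -> triple c2 s T Q) ->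
  triple (If b c1 c2) s T.+2 Q.
Proof.
move=> H1 H2 P base /= /code_at_cons[/(steps_jump_if s) st0].
case/code_at_cat=> C2 /code_at_cons[/steps_jump st3 C1].
case: ifPn st0 => hb st0.
  have [t [s' [st le Qs]]] := H1 hb _ _ C1.
  exists (1 + t)%N, s'; split=> //; last by rewrite add1n; apply: leqW.
  rewrite (steps_trans st0 st); congr (Some (goto _ _)).
  by rewrite size_cat /=; lia.
have [t [s' [st le Qs]]] := H2 hb _ _ C2.
exists (1 + (t + 1))%N, s'; split=> //; last by lia.
rewrite (steps_trans st0 (steps_trans st (st3 _))) //.
by congr (Some (goto _ _)); rewrite size_cat /=; lia.
Qed.

(** [I m] is the invariant when [m] iterations remain. *)
Lemma triple_while b c T (I : nat -> state R -> Prop) :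
  (forall m s, I m s -> holds b s = (0 < m)%N) ->
  (forall m s, I m.+1 s -> triple c s T (I m)) ->
  forall m s, I m s -> triple (While b c) s (m * T.+2).+2 (I 0%N).
Proof.
move=> Ib Ic m s Ims P base /=.
case/code_at_cons=> /steps_jump_if st0 /code_at_cons[/steps_jump st1].
case/code_at_cat=> Cc /code_at_cons[/steps_jump st2 _].
(* Each round pays for the test and the jump back besides the body; leaving the loop costs a failed
   test and the jump out. *)
elim: m s Ims => [|m IH] s Ims; move: (st0 s) (Ib _ _ Ims) => st0s hb.
  rewrite hb in st0s; exists (1 + 1)%N, s; split=> //.
  rewrite (steps_trans st0s (st1 _)) size_cat.
  by congr (Some (goto _ _)); rewrite /=; lia.
rewrite hb in st0s; have [t [s1 [st le Is1]]] := Ic _ _ Ims _ _ Cc.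
have [t' [s' [st' le' Is']]] := IH _ Is1.
exists (1 + (t + (1 + t')))%N, s'; split=> //; last by lia.
by rewrite (steps_trans st0s (steps_trans st (steps_trans (st2 _) st'))).
Qed.

End Triples.

(** * Prickliness as the depth of a family of intervals *)

Section Depth.
Variables (R : realType).

(** A line of slope [a] through the middle point passes above both others exactly when [a] lies
    strictly between the two edge slopes; conversely their midpoint is a valid [a]. *)
Lemma slope_convexE (x0 y0 x1 y1 x2 y2 : R) : x0 < x1 -> x1 < x2 ->
  (exists a b, [/\ y1 = a * x1 + b, y0 < a * x0 + b & y2 < a * x2 + b])
  <-> (y2 - y1) / (x2 - x1) < (y1 - y0) / (x1 - x0).
Proof.
move=> lt01 lt12.
have p0 : 0 < x1 - x0 by rewrite subr_gt0.
have p1 : 0 < x2 - x1 by rewrite subr_gt0.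
split=> [[a [b [-> lt0 lt2]]]|lts].
  apply: (@lt_trans _ _ a); first by rewrite ltr_pdivrMr //; lra.
  by rewrite ltr_pdivlMr //; lra.
have [] := midf_lt lts; set a := (_ / 2).
rewrite ltr_pdivrMr // ltr_pdivlMr // => ? ?.
by exists a, (y1 - a * x1); split; lra.
Qed.

(** [- w1 / w2] is the slope of the level lines of the scalar product with [(w1, w2)]. *)
Lemma dot_slopeE (x y u v w1 w2 : R) : x < u -> 0 < w2 ->
  (x * w1 + y * w2 < u * w1 + v * w2) = (- w1 / w2 < (v - y) / (u - x)).
Proof.
move=> ltx w20; rewrite ltr_pdivlMr ?subr_gt0 //.
set m := - w1 / w2.
have -> : w1 = - m * w2 by rewrite /m mulNr divfK ?opprK // gt_eqF.
rewrite -subr_gt0 -[RHS]subr_gt0 -[RHS](pmulr_rgt0 _ w20).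
by congr (_ < _); ring.
Qed.

Lemma dot_slopeE_opp (x y u v w1 w2 : R) : x < u -> 0 < w2 ->
  (u * w1 + v * w2 < x * w1 + y * w2) = ((v - y) / (u - x) < - w1 / w2).
Proof.
move=> ltx w20; rewrite ltr_pdivrMr ?subr_gt0 //.
set m := - w1 / w2.
have -> : w1 = - m * w2 by rewrite /m mulNr divfK ?opprK // gt_eqF.
rewrite -subr_gt0 -[RHS]subr_gt0 -[RHS](pmulr_rgt0 _ w20).
by congr (_ < _); ring.
Qed.

Variables (n : nat) (T : n.-tuple (R * R)).
Hypothesis terT : terrain T.

Definition slope (i : nat) : R :=
  ((nth (0, 0) T i.+1).2 - (nth (0, 0) T i).2)
  / ((nth (0, 0) T i.+1).1 - (nth (0, 0) T i).1).

Definition crossing (m : R) (i : nat) : bool := slope i < m < slope i.-1.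

(** For an upward [w] the two scalar product comparisons are the two inequalities of [crossing], and
    convexity follows from them by transitivity. *)
Lemma convex_local_maxE (w : R * R) (i : 'I_n) : internal i ->
  `[< convex_vertex T i >] && local_max T w i
  = (0 < w.2) && crossing (- w.1 / w.2) i.
Proof.
case: i => -[|i] lti //= /andP[_ /= lti2].
pose i0 := Ordinal (ltnW lti); pose i1 := Ordinal lti; pose i2 := Ordinal lti2.
have lt01 : (tnth T i0).1 < (tnth T i1).1 by apply: terT => /=.
have lt12 : (tnth T i1).1 < (tnth T i2).1 by apply: terT => /=.
have nbE j : neighbor i1 j = (j == i0) || (j == i2).
  rewrite /neighbor -!val_eqE /= orbC eqSS; congr (_ || _); exact: eq_sym.
have cvE : `[< convex_vertex T i1 >] = (slope i.+1 < slope i).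
  have E := slope_convexE (tnth T i0).2 (tnth T i1).2 (tnth T i2).2 lt01 lt12.
  rewrite /slope -!(tnth_nth _ _ i0) -!(tnth_nth _ _ i1) -!(tnth_nth _ _ i2).
  apply/asboolP/idP => [[a [b [e H]]]|/E[a [b [e H0 H2]]]].
    by apply/E; exists a, b; split=> //; apply: H; rewrite nbE eqxx ?orbT.
  by exists a, b; split=> // j; rewrite nbE => /orP[]/eqP->.
have lmE : local_max T w i1 =
    (dot (tnth T i0) w < dot (tnth T i1) w)
    && (dot (tnth T i2) w < dot (tnth T i1) w).
  apply/forallP/andP => [H|[H0 H2] j].
    by split; apply: (implyP (H _)); rewrite nbE eqxx ?orbT.
  by apply/implyP; rewrite nbE => /orP[]/eqP->.
rewrite cvE lmE /crossing /=; have [w20|w20] := ltP 0 w.2.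
  rewrite dot_slopeE // dot_slopeE_opp //.
  rewrite /slope -!(tnth_nth _ _ i0) -!(tnth_nth _ _ i1) -!(tnth_nth _ _ i2).
  rewrite andTb; apply/and3P/andP => [[]//|[H1 H2]].
  by split=> //; exact: lt_trans H1 H2.
(* Let [w.2 <= 0]. Replacing both neighbors by the points above them on the line of slope [a] does
   not increase their scalar product with [w]. So [w.1 + a * w.2] would have to be positive because
   of the left neighbor and negative because of the right one. *)
rewrite /= -cvE; apply/negP => /andP[/asboolP[a [b [e H]]] /andP[]].
have {}H0 := H i0; have {}H2 := H i2; rewrite !nbE !eqxx orbT in H0 H2.
move: (H0 isT) (H2 isT); rewrite /dot; move: (tnth T i0) (tnth T i2) lt01 lt12.
move=> [x0 y0] [x2 y2] /=; rewrite e.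
move: (tnth T i1).1 w.1 w.2 w20 => x1 w1 w2 w20 lt01 lt12 h0 h2 g0 g2.
have k0 : (a * x0 + b) * w2 <= y0 * w2 by rewrite ler_wnM2r // ltW.
have k2 : (a * x2 + b) * w2 <= y2 * w2 by rewrite ler_wnM2r // ltW.
have : 0 < (x1 - x0) * (w1 + a * w2) by lra.
have : 0 < (x1 - x2) * (w1 + a * w2) by lra.
by rewrite nmulr_rgt0 ?subr_lt0 // pmulr_rgt0 ?subr_gt0 // => /ltW/le_gtF->.
Qed.

(** * Prickliness as a count over edge slopes, and its endpoint events *)

Lemma count_ord (p : pred nat) : #|[pred i : 'I_n | p i]| = count p (iota 0 n).
Proof.
rewrite -val_enum_ord count_map -size_filter cardE {1}/enum_mem enumT.
by congr size; apply: eq_filter.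
Qed.

Lemma count_internal (p : pred nat) :
  count (fun i => [&& (0 < i)%N, (i.+1 < n)%N & p i]) (iota 0 n)
  = count p (iota 1 (n - 2)).
Proof.
have [lt1|] := ltnP 1 n; last first.
  move=> le1; have -> : (n - 2 = 0)%N by lia.
  by rewrite /= (@eq_in_count _ _ pred0) ?count_pred0 // => i _ /=; lia.
have -> : iota 0 n = [:: 0%N] ++ iota 1 (n - 2) ++ [:: n.-1].
  have {1}-> : n = (1 + ((n - 2) + 1))%N by lia.
  by rewrite iotaD iotaD; congr (_ ++ _ ++ [:: _]); lia.
rewrite !count_cat /= (_ : (n.-1.+1 < n)%N = false) ?andbF; last by lia.
rewrite !add0n addn0; apply: eq_in_count => i; rewrite mem_iota => /andP[lei lti].
by rewrite lei (_ : (i.+1 < n)%N); last by lia.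
Qed.

Lemma prickliness_dirE (w : R * R) : prickliness_dir T w =
  if 0 < w.2 then count (crossing (- w.1 / w.2)) (iota 1 (n - 2)) else 0%N.
Proof.
rewrite /prickliness_dir.
transitivity #|[pred i : 'I_n | [&& (0 < i)%N, (i.+1 < n)%N &
    (0 < w.2) && crossing (- w.1 / w.2) i]]|.
  apply: eq_card => i; rewrite !inE.
  have [int_i|ext_i] := boolP (internal i); rewrite [RHS]andbA -/(internal i).
    by rewrite int_i convex_local_maxE.
  by rewrite (negbTE ext_i).
rewrite (count_ord (fun i => [&& (0 < i)%N, (i.+1 < n)%N &
    (0 < w.2) && crossing (- w.1 / w.2) i])) count_internal.
by case: ifP => _ //=; rewrite count_pred0.
Qed.

(** A descent of slopes at [i] contributes the half-open interval
    [slope i, slope i.-1[: an opening event (tag 1) and a closing one (tag 2). *)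
Definition vertex_events (i : nat) : seq (R * nat) :=
  if slope i < slope i.-1 then [:: (slope i, 1%N); (slope i.-1, 2%N)] else [::].

Definition events : seq (R * nat) :=
  flatten [seq vertex_events i | i <- iota 1 (n - 2)].

Definition has_tag (k : nat) : pred (R * nat) := fun e => e.2 == k.

Definition has_tag_le (k : nat) (v : R) : pred (R * nat) :=
  fun e => (e.2 == k) && (e.1 <= v).

(** Vertex by vertex: an interval contains [v] when its opening endpoint is at most [v] and its
    closing one is not. The additive form avoids truncated subtraction. *)
Lemma count_events (v : R) : count (has_tag_le 1 v) events =
  (count (has_tag_le 2 v) events
   + count (fun i => (slope i <= v < slope i.-1)%R) (iota 1 (n - 2)))%N.
Proof.
rewrite /events; elim: iota => //= i l IH; rewrite !count_cat IH.
rewrite /vertex_events; have [lt|ge] := ltP (slope i) (slope i.-1); last first.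
  rewrite (_ : (_ <= v < _) = false) //; apply/negP => /andP[le1 lt1].
  by have := le_lt_trans le1 lt1; rewrite ltNge ge.
rewrite /= /has_tag_le /= !addn0; have [le1|gt1] := leP (slope i.-1) v.
  by rewrite (le_trans (ltW lt) le1) /=; lia.
by case: (slope i <= v) => /=; lia.
Qed.

(** A prefix that ends between two equal keys cuts through a group of ties, and its balance need not
    be the depth at any point; such positions get the neutral value 0. *)
Definition sweep_depth (xs : seq (R * nat)) (e : nat) : nat :=
  if (nth (0, 0%N) xs e).1 < (nth (0, 0%N) xs e.+1).1
  then (count (has_tag 1) (take e.+1 xs) - count (has_tag 2) (take e.+1 xs))%N else 0%N.

(** Links the sweep, which counts over prefixes, with [count_events], which counts up to a
    threshold. *)
Lemma count_take_sorted (xs : seq (R * nat)) (k p : nat) (v : R) :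
  (forall i, (i < p)%N -> (nth (0, 0%N) xs i).1 <= v) ->
  (forall i, (p <= i < size xs)%N -> v < (nth (0, 0%N) xs i).1) ->
  count (has_tag k) (take p xs) = count (has_tag_le k v) xs.
Proof.
move=> H1 H2; rewrite -{2}(cat_take_drop p xs) count_cat.
rewrite [X in (_ + X)%N](_ : _ = 0%N) ?addn0; last first.
  apply/eqP; rewrite -leqn0 leqNgt -has_count; apply/negP => /(has_nthP (0, 0%N)).
  case=> i; rewrite size_drop nth_drop /has_tag_le => lti /andP[_]; rewrite leNgt H2 //.
  by rewrite leq_addr -ltn_subRL.
apply: eq_in_count => e /(nthP (0, 0%N))[i]; rewrite size_take_min leq_min.
by case/andP=> lti _; rewrite nth_take // /has_tag /has_tag_le => <-; rewrite H1 ?andbT.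
Qed.

Lemma sorted_nth_le (xs : seq (R * nat)) i j : sorted (fun e f => e.1 <= f.1) xs ->
  (i <= j < size xs)%N -> (nth (0, 0%N) xs i).1 <= (nth (0, 0%N) xs j).1.
Proof.
move=> srt /andP[leij ltj].
apply: (sorted_leq_nth (leT := fun e f : R * nat => e.1 <= f.1)) => //.
- by move=> ? ? ?; apply: le_trans.
- by rewrite inE (leq_ltn_trans leij).
Qed.

(** The padding events of the sorted array have tag 0 and do not count. *)
Lemma sweep_prickliness (xs : seq (R * nat)) k :
  sorted (fun e f => e.1 <= f.1) xs ->
  perm_eq xs (events ++ nseq k (0, 0%N)) ->
  (\max_(0 <= e < (size xs).-1) sweep_depth xs e)%N = prickliness T.
Proof.
move=> srt pm.
have cnt t v : (0 < t)%N -> count (has_tag_le t v) xs = count (has_tag_le t v) events.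
  move=> t0; rewrite (permP pm) count_cat count_nseq /has_tag_le /=.
  by case: t t0 => //= t _; rewrite mul0n addn0.
have depth v : (count (has_tag_le 1 v) xs - count (has_tag_le 2 v) xs)%N
    = count (fun i => (slope i <= v < slope i.-1)%R) (iota 1 (n - 2)).
  by rewrite !cnt // count_events addKn.
apply/eqP; rewrite eqn_leq; apply/andP; split.
  rewrite big_mkord; apply/bigmax_leqP => -[e lte] _ /=.
  rewrite /sweep_depth; case: ifP => // ltk.
  have lte' : (e.+1 < size xs)%N by move: lte; case: size.
  (* The midpoint of the gap separates the prefix from the rest; the direction [(- v, 1)] then
     realizes the depth at [v]. *)
  have [] := midf_lt ltk; set v := (_ / 2) => lt1 lt2.
  have pre i : (i < e.+1)%N -> (nth (0, 0%N) xs i).1 < v.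
    by move=> lei; apply: le_lt_trans lt1; apply: sorted_nth_le => //; lia.
  have post i : (e.+1 <= i < size xs)%N -> v < (nth (0, 0%N) xs i).1.
    by move=> lei; apply: lt_le_trans lt2 _; apply: sorted_nth_le.
  rewrite !(@count_take_sorted _ _ _ v) //; try by move=> i /pre/ltW.
  rewrite depth; apply: leq_trans (prickliness_dir_le T (- v, 1)).
  rewrite prickliness_dirE /= ltr01 opprK divr1; apply/eq_leq.
  apply: eq_in_count => i ii; rewrite /crossing [in RHS]lt_neqAle.
  case: (ltP v (slope i.-1)) => lti; last by rewrite !andbF.
  rewrite !andbT; case: eqP => // eqv.
  (* Open and half-open intervals could differ only if [v] were an opening endpoint, but no key of
     [xs] lies inside the gap. *)
  have : (slope i, 1%N) \in xs.
    rewrite (perm_mem pm) mem_cat; apply/orP; left; apply/flattenP.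
    exists (vertex_events i); first exact: map_f.
    by rewrite /vertex_events eqv lti inE eqxx.
  move=> /(nthP (0, 0%N))[j ltj ej]; have [ltje|leje] := ltnP j e.+1.
    by have := pre j ltje; rewrite ej /= eqv ltxx.
  by have := post j; rewrite ej /= eqv ltxx leje ltj => /(_ isT).
have [w <-] := prickliness_attained T; rewrite prickliness_dirE.
case: ifP => // _; set m := - w.1 / w.2.
have [->//|] := posnP (count (crossing m) (iota 1 (n - 2))).
(* A nonzero depth at [m] provides an interval around [m]. Its endpoints lie on both sides of the
   cut [p] after the keys at most [m], so [0 < p < size xs] and the gap [p.-1] exists. *)
rewrite -has_count => /hasP[i0 ii0 /andP[lo hi]].
have [p pP] : exists p, forall i, (i < size xs)%N ->
    ((nth (0, 0%N) xs i).1 <= m) = (i < p)%N.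
  have srt' : sorted <=%O (map fst xs) by rewrite sorted_map.
  exists (count (fun x => x <= m) (map fst xs)) => i lti.
  rewrite -(nth_map _ 0) //; have [ltp|lep] := ltnP i _.
    exact: nth_count_le.
  by apply/negbTE; rewrite -ltNge; apply: nth_count_gt => //; rewrite size_map lep.
have inxs e : e \in vertex_events i0 -> e \in xs.
  move=> ein; rewrite (perm_mem pm) mem_cat; apply/orP; left; apply/flattenP.
  by exists (vertex_events i0) => //; exact: map_f.
have desc : slope i0 < slope i0.-1 := lt_trans lo hi.
have /inxs/(nthP (0, 0%N))[j1 lt1 e1] : (slope i0, 1%N) \in vertex_events i0.
  by rewrite /vertex_events desc inE eqxx.
have /inxs/(nthP (0, 0%N))[j2 lt2 e2] : (slope i0.-1, 2%N) \in vertex_events i0.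
  by rewrite /vertex_events desc !inE eqxx orbT.
have := pP _ lt1; rewrite e1 /= (ltW lo) => /esym ltp1.
have := pP _ lt2; rewrite e2 /= leNgt hi /= => /esym/negbT; rewrite -leqNgt => lep2.
have p0 : p = p.-1.+1 by rewrite prednK //; lia.
have ltps : (p < size xs)%N := leq_ltn_trans lep2 lt2.
apply: (@leq_trans (sweep_depth xs p.-1)); last first.
  rewrite big_mkord; have lt : (p.-1 < (size xs).-1)%N.
    by rewrite ltn_predRL -p0.
  exact: (leq_bigmax (Ordinal lt)).
rewrite /sweep_depth -p0 ifT; last first.
  apply: (@le_lt_trans _ _ m); first by rewrite pP; lia.
  by rewrite ltNge pP // ltnn.
rewrite !(@count_take_sorted _ _ _ m) //; try by move=> i ltip; rewrite pP //; lia.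
(* Every open interval is contained in its half-open version, so an inequality suffices here. *)
- rewrite depth; apply: sub_count => i /andP[lt' ->]; rewrite andbT; exact: ltW.
- by move=> i /andP[? ?]; rewrite ltNge pP // -leqNgt.
- by move=> i /andP[? ?]; rewrite ltNge pP // -leqNgt.
Qed.

End Depth.

(** * Merging *)

(** [ri], [rj] and [rk] point into the two runs being merged and the output;
    [rie], [rje] and [rke] are the corresponding ends. *)
Local Notation rn := 0%N.
Local Notation r1 := 1%N.
Local Notation rN := 2%N.
Local Notation rw := 3%N.
Local Notation rh := 4%N.
Local Notation rlim := 5%N.
Local Notation ri := 6%N.
Local Notation rie := 7%N.
Local Notation rj := 8%N.
Local Notation rje := 9%N.
Local Notation rk := 10%N.
Local Notation rke := 11%N.
Local Notation rt := 12%N.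
Local Notation ru := 13%N.
Local Notation rup := 14%N.
Local Notation rdn := 15%N.
Local Notation rz := 16%N.

Definition take_from (x : nat) : cmd :=
  Block [:: ILoad rt x; FLoad 0 x; IStore rk rt; FStore rk 0;
            IAdd x x r1; IAdd rk rk r1].

Definition merge_step : cmd :=
  If (TestI ri rie)
    (If (TestI rj rje)
      (Seq (Block [:: FLoad 1 ri; FLoad 2 rj])
           (If (TestF 2 1) (take_from rj) (take_from ri)))
      (take_from ri))
    (take_from rj).

Definition merge_runs : cmd := While (TestI rk rke) merge_step.

(** * Segments of memory and the correctness of merging *)

Section Memory.
Variable R : realType.
Implicit Types (s : state R).

(** Only a preorder: events with equal keys may come in any order, as the sweep reads no depth
    between them. *)
Definition leE : rel (R * nat) := fun e f => e.1 <= f.1.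

Lemma leE_total : total leE.
Proof. by move=> ? ?; apply: le_total. Qed.

(** An event is split over the two memories, with its key and its tag at the same address. *)
Definition cell s (a : nat) : R * nat := (fmem s a, imem s a).

Definition arr s (a l : nat) : seq (R * nat) := [seq cell s k | k <- iota a l].

Lemma size_arr s a l : size (arr s a l) = l.
Proof. by rewrite size_map size_iota. Qed.

Lemma eq_arr s s' a l :
  (forall k, (a <= k < a + l)%N -> cell s k = cell s' k) ->
  arr s a l = arr s' a l.
Proof. by move=> eqc; apply/eq_in_map => k; rewrite mem_iota; apply: eqc. Qed.

Lemma arrD s a l1 l2 : arr s a (l1 + l2) = arr s a l1 ++ arr s (a + l1) l2.
Proof. by rewrite /arr iotaD map_cat. Qed.

Lemma arrS s a l : arr s a l.+1 = rcons (arr s a l) (cell s (a + l)%N).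
Proof. by rewrite -addn1 arrD cats1. Qed.

Lemma arr_cons s a l : arr s a l.+1 = cell s a :: arr s a.+1 l.
Proof. by []. Qed.

Lemma nth_arr x0 s a l i : (i < l)%N -> nth x0 (arr s a l) i = cell s (a + i)%N.
Proof. by move=> lti; rewrite (nth_map 0%N) ?size_iota // nth_iota. Qed.

Definition took x s s' := [/\ ireg s' x = (ireg s x).+1,
  ireg s' rk = (ireg s rk).+1,
  (forall r, r \notin [:: x; rk; rt] -> ireg s' r = ireg s r) &
  forall a, cell s' a = if a == ireg s rk then cell s (ireg s x) else cell s a].

Lemma triple_take_from x s : x \in [:: ri; rj] -> ireg s r1 = 1%N ->
  triple (take_from x) s 6 (took x s).
Proof.
move=> xij s1; apply: triple_block; first by [].
rewrite !inE in xij; case/orP: xij => /eqP->;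
 (split; rewrite /cell /= /upd /= ?s1 ?addn1 //;
  [move=> r; rewrite !inE !negb_or => /and3P[]; do 3!case: eqP => //
  |by move=> a; case: eqP]).
Qed.

(** The conserved quantity is the output written so far followed by the merge of the unread parts of
    the runs, of lengths [l1] and [l2]; [s0] is the state before merging. *)
Definition merge_at s0 (m : nat) s (l1 l2 : nat) : Prop :=
  [/\ [/\ m = (l1 + l2)%N, ireg s0 rie = (ireg s ri + l1)%N,
          ireg s0 rje = (ireg s rj + l2)%N,
          ireg s0 rke = (ireg s rk + m)%N & (ireg s0 rk <= ireg s rk)%N],
      arr s (ireg s0 rk) (ireg s rk - ireg s0 rk)
        ++ merge leE (arr s (ireg s ri) l1) (arr s (ireg s rj) l2)
      = merge leE (arr s0 (ireg s0 ri) (ireg s0 rie - ireg s0 ri))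
                  (arr s0 (ireg s0 rj) (ireg s0 rje - ireg s0 rj)),
      (forall r, r \notin [:: ri; rj; rk; rt] -> ireg s r = ireg s0 r) &
      (forall a, (a < ireg s0 rk)%N -> cell s a = cell s0 a)].

Definition merge_inv s0 (m : nat) s : Prop := exists l1 l2, merge_at s0 m s l1 l2.

Lemma took_arr x s s' k0 a l : took x s s' -> (k0 <= ireg s rk)%N ->
  (a + l <= ireg s rk)%N -> arr s' a l = arr s a l.
Proof.
move=> [_ _ _ ec] le1 le2; apply: eq_arr => k /andP[_ lek].
by rewrite ec; case: eqP => // ?; lia.
Qed.

Lemma took_out x s s' k0 : took x s s' -> (k0 <= ireg s rk)%N ->
  arr s' k0 (ireg s' rk - k0)
  = rcons (arr s k0 (ireg s rk - k0)) (cell s (ireg s x)).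
Proof.
move=> tk le1; have [_ -> _ ec] := tk; rewrite subSn // arrS subnKC // ec eqxx.
by rewrite (took_arr tk le1) ?subnKC.
Qed.

(** Ties are resolved in favor of the first run, as [merge] does; hence the weak comparison here and
    the strict one in [merge_take_j]. The runs end before the output, so the write leaves their
    unread parts intact. *)
Lemma merge_take_i s0 s s' m l1 l2 : took ri s s' ->
  (ireg s0 rie <= ireg s0 rk)%N -> (ireg s0 rje <= ireg s0 rk)%N ->
  merge_at s0 m.+1 s l1 l2 -> (0 < l1)%N ->
  (l2 = 0%N \/ fmem s (ireg s ri) <= fmem s (ireg s rj)) ->
  merge_at s0 m s' l1.-1 l2.
Proof.
move=> tk le1 le2 [[e1 e2 e3 e4 e5] ev fr fc] l10 cmp.
have [t1 t2 t3 t4] := tk; rewrite /merge_at (took_out tk e5) t1 t2 t3 //; split.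
- by split; lia.
- rewrite -ev !(took_arr tk e5) ?cat_rcons //; try lia.
  congr cat; rewrite -{2}(prednK l10); case: l2 cmp {e1 e3 ev} => [|l2].
    have merges0 (z : seq (R * nat)) : merge leE z [::] = z by case: z.
    by rewrite !merges0.
  by case=> // cmp; rewrite !arr_cons /= [leE _ _]cmp.
- move=> r H; rewrite t3 ?fr //; move: H; rewrite !inE !negb_or.
  by case/and4P=> -> _ -> ->.
- by move=> a lta; rewrite t4 -fc //; case: eqP => // ?; lia.
Qed.

Lemma merge_take_j s0 s s' m l1 l2 : took rj s s' ->
  (ireg s0 rie <= ireg s0 rk)%N -> (ireg s0 rje <= ireg s0 rk)%N ->
  merge_at s0 m.+1 s l1 l2 -> (0 < l2)%N ->
  (l1 = 0%N \/ fmem s (ireg s rj) < fmem s (ireg s ri)) ->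
  merge_at s0 m s' l1 l2.-1.
Proof.
move=> tk le1 le2 [[e1 e2 e3 e4 e5] ev fr fc] l20 cmp.
have [t1 t2 t3 t4] := tk; rewrite /merge_at (took_out tk e5) t1 t2 t3 //; split.
- by split; lia.
- rewrite -ev !(took_arr tk e5) ?cat_rcons //; try lia.
  congr cat; rewrite -{2}(prednK l20); case: l1 cmp {e1 e2 ev} => [|l1] //.
  by case=> // cmp; rewrite !arr_cons /= [leE _ _]leNgt cmp.
- move=> r H; rewrite t3 ?fr //; move: H; rewrite !inE !negb_or.
  by case/and4P=> _ -> -> ->.
- by move=> a lta; rewrite t4 -fc //; case: eqP => // ?; lia.
Qed.

(** The longest path has three conditionals at 2 steps each, two loads and the 6 instructions of
    [take_from]. *)
Lemma triple_merge_step s0 m s : ireg s0 r1 = 1%N ->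
  (ireg s0 rie <= ireg s0 rk)%N -> (ireg s0 rje <= ireg s0 rk)%N ->
  merge_inv s0 m.+1 s -> triple merge_step s 14 (merge_inv s0 m).
Proof.
move=> s1 le1 le2 [l1 [l2 at12]].
have [[e1 e2 e3 e4 e5] _ fr _] := at12.
have s1' : ireg s r1 = 1%N by rewrite fr.
have tk x s' : x \in [:: ri; rj] -> ireg s' r1 = 1%N ->
    triple (take_from x) s' 12 (took x s').
  by move=> xij s1x; apply: triple_weaken (triple_take_from xij s1x) _ _.
apply: triple_if; rewrite /= (fr rie) // e2 -{1}[ireg s ri]addn0 ltn_add2l.
- move=> l10; apply: (@triple_weaken _ _ _ 12 _ (merge_inv s0 m)) => //.
  apply: (@triple_if _ _ _ _ _ 10).
    rewrite /= (fr rje) // e3 -{1}[ireg s rj]addn0 ltn_add2l => l20.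
    apply: (@triple_seq _ _ _ _ 2 8 (fun s' => s' =
       set_freg (set_freg s 1 (fmem s (ireg s ri))) 2 (fmem s (ireg s rj)))).
      by apply: triple_block; first by [].
    move=> _ ->; apply: triple_if; rewrite /= /upd /=.
      move=> lt; apply: triple_weaken (triple_take_from _ _) _ _ => //.
      move=> s' tk'; exists l1, l2.-1.
      by apply: merge_take_j tk' _ _ at12 _ _ => //; right.
    rewrite -leNgt => lt.
    apply: triple_weaken (triple_take_from _ _) _ _ => //.
    move=> s' tk'; exists l1.-1, l2.
      by apply: merge_take_i tk' _ _ at12 _ _ => //; right.
  rewrite /= (fr rje) // e3 -{1}[ireg s rj]addn0 ltn_add2l -eqn0Ngt => /eqP l20.
  apply: triple_weaken (triple_take_from _ _) _ _ => //.
  move=> s' tk'; exists l1.-1, l2.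
  by apply: merge_take_i tk' _ _ at12 _ _ => //; left.
- rewrite -eqn0Ngt => /eqP l10.
  apply: triple_weaken (triple_take_from _ _) _ _ => //.
  move=> s' tk'; exists l1, l2.-1.
  by apply: merge_take_j tk' _ _ at12 _ _ => //; [lia|left].
Qed.

Lemma triple_merge_runs s0 l1 l2 : ireg s0 r1 = 1%N ->
  ireg s0 rie = (ireg s0 ri + l1)%N -> ireg s0 rje = (ireg s0 rj + l2)%N ->
  ireg s0 rke = (ireg s0 rk + (l1 + l2))%N ->
  (ireg s0 rie <= ireg s0 rk)%N -> (ireg s0 rje <= ireg s0 rk)%N ->
  triple merge_runs s0 ((l1 + l2) * 16).+2 (fun s =>
    [/\ arr s (ireg s0 rk) (l1 + l2)
        = merge leE (arr s0 (ireg s0 ri) l1) (arr s0 (ireg s0 rj) l2),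
      (forall r, r \notin [:: ri; rj; rk; rt] -> ireg s r = ireg s0 r) &
      (forall a, (a < ireg s0 rk)%N -> cell s a = cell s0 a)]).
Proof.
move=> s1 e1 e2 e3 le1 le2.
have := @triple_while R (TestI rk rke) merge_step 14 (merge_inv s0) _ _
  (l1 + l2)%N s0.
move=> H; apply: triple_weaken (H _ _ _) (leqnn _) _.
- by move=> m s [? [? [[_ _ _ e _] _ fr _]]] /=; rewrite (fr rke) // e; lia.
- by move=> m s; apply: triple_merge_step.
- exists l1, l2; split=> //; rewrite subnn e1 e2.
  by congr (_ ++ merge _ (arr _ _ _) (arr _ _ _)); lia.
- move=> s [[|?] [[|?]]] [] [] // _ ? ? e ? ev fr fc; split=> //.
  move: ev; rewrite /= cats0 e1 e2 !addKn => <-.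
  by congr arr; lia.
Qed.

(** * Bottom-up merge sort *)

Definition merge_block : cmd :=
  Seq (Block [:: IAdd ri rh rz; IAdd rie rh rw; IAdd rj rie rz; IAdd rje rj rw;
                 IAdd rk rh rN; IAdd rke rk rw; IAdd rke rke rw])
  (Seq merge_runs (Block [:: IAdd rh rje rz])).

(** A pass reads the [N] cells from [rh] on and writes the next [N] cells, so
    that no event is ever overwritten. *)
Definition merge_pass : cmd :=
  Seq (Block [:: IAdd rlim rh rN])
  (Seq (While (TestI rh rlim) merge_block) (Block [:: IAdd rw rw rw])).

Definition merge_sort : cmd := While (TestI rw rN) merge_pass.

Definition sort_regs s (N w h : nat) : Prop :=
  [/\ ireg s r1 = 1, ireg s rz = 0, ireg s rN = N, ireg s rw = w &
      ireg s rh = h]%N.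

(** The bound [w + w <= N] puts both runs below the output at [h + N]. *)
Lemma triple_merge_block s N w h : sort_regs s N w h -> (w + w <= N)%N ->
  triple merge_block s (10 + 32 * w) (fun s' =>
    [/\ sort_regs s' N w (h + (w + w)), ireg s' rlim = ireg s rlim,
      arr s' (h + N) (w + w) = merge leE (arr s h w) (arr s (h + w) w) &
      forall a, (a < h + N)%N -> cell s' a = cell s a]).
Proof.
move=> [e1 ez eN ew eh] lewN.
pose s1 := odflt s (run_block [:: IAdd ri rh rz; IAdd rie rh rw; IAdd rj rie rz;
  IAdd rje rj rw; IAdd rk rh rN; IAdd rke rk rw; IAdd rke rke rw] s).
apply: triple_weaken (_ : (7 + (((w + w) * 16).+2 + 1) <= _)%N) (fun s' H => H);
  last by lia.
apply: (@triple_seq _ _ _ _ 7 _ (fun s' => s' = s1)).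
  by apply: triple_block; first by [].
move=> _ ->.
have si : ireg s1 ri = h by rewrite /s1 /= /upd /= eh ez addn0.
have sie : ireg s1 rie = (h + w)%N by rewrite /s1 /= /upd /= eh ew.
have sj : ireg s1 rj = (h + w)%N by rewrite /s1 /= /upd /= eh ew ez addn0.
have sje : ireg s1 rje = (h + w + w)%N by rewrite /s1 /= /upd /= eh ew ez addn0.
have sk : ireg s1 rk = (h + N)%N by rewrite /s1 /= /upd /= eh eN.
have ske : ireg s1 rke = (h + N + w + w)%N by rewrite /s1 /= /upd /= eh eN ew.
apply: triple_seq.
  apply: (triple_merge_runs (s0 := s1) (l1 := w) (l2 := w));
    rewrite ?si ?sie ?sj ?sje ?sk ?ske //; lia.
move=> s2 []; rewrite si sj sk => ev fr fc.
apply: triple_block; first by [].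
have fr' r : r \notin [:: ri; rie; rj; rje; rk; rke; rt] -> ireg s2 r = ireg s r.
  rewrite !inE !negb_or => H; rewrite fr; last first.
    by rewrite !inE !negb_or; case/and5P: H => -> _ -> _ /and3P[-> _ ->].
  move: H; rewrite /s1 /= /upd; do 7!case: eqP => //.
split=> //; last by rewrite /= /upd /= fr'.
split; rewrite /= /upd /=; do 4?[by rewrite fr'].
by rewrite fr // sje fr' // ez addn0 addnA.
Qed.

Definition runs_sorted s (b w m : nat) : Prop :=
  forall q, (q < m)%N -> sorted leE (arr s (b + q * w) w).

Lemma triple_merge_pass s N w h m : sort_regs s N w h -> (0 < w)%N ->
  N = (m.+1 * (w + w))%N -> runs_sorted s h w (m.+1 + m.+1) ->
  triple merge_pass s (26 * N) (fun s' =>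
    [/\ sort_regs s' N (w + w) (h + N), runs_sorted s' (h + N) (w + w) m.+1 &
      perm_eq (arr s' (h + N) N) (arr s h N)]).
Proof.
move=> rs w0 EN srt.
pose I k s' := exists2 d, (d + k = m.+1)%N &
  [/\ sort_regs s' N w (h + d * (w + w)), ireg s' rlim = (h + N)%N,
      runs_sorted s' (h + N) (w + w) d,
      perm_eq (arr s' (h + N) (d * (w + w))) (arr s h (d * (w + w))) &
      forall a, (a < h + N)%N -> cell s' a = cell s a].
(* There are [m.+1] blocks with [N = m.+1 * (w + w)]; as [w] is at least 1, the constant overheads
   are absorbed into [26 * N]. *)
apply: triple_weaken (_ : (1 + ((m.+1 * (10 + 32 * w).+2).+2 + 1) <= _)%N)
  (fun s' H => H); last by nia.
apply: (@triple_seq _ _ _ _ 1 _ (I m.+1)).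
  apply: triple_block; first by [].
  case: rs => e1 ez eN ew eh; exists 0%N; first by rewrite add0n.
  by split=> //; rewrite /= /upd /= ?eh ?eN // mul0n addn0.
move=> s1 Is1; apply: (@triple_seq _ _ _ _ _ _ (I 0%N)).
  apply: triple_while Is1 => k s2.
    move=> [d dk [[_ _ _ _ eh] el _ _ _]]; rewrite /= eh el EN ltn_add2l.
    by rewrite ltn_pmul2r; lia.
  move=> [d dk [rs2 el sr pm fc]].
  have led : ((d.+1) * (w + w) <= N)%N by rewrite EN leq_pmul2r; lia.
  apply: triple_weaken (triple_merge_block rs2 _) (leqnn _) _.
    by move: led; rewrite mulSn; lia.
  move=> s3 [rs3 el3 ev fc3]; exists d.+1; first by lia.
  (* The two runs of this block lie below [h + N], where nothing has been written since the pass
     began. *)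
  have in2 l o : (o + l <= w + w)%N ->
      arr s2 (h + d * (w + w) + o) l = arr s (h + d * (w + w) + o) l.
    by move=> leo; apply: eq_arr => a ina; apply: fc; move: led; rewrite mulSn; lia.
  have in1 := in2 w 0%N; rewrite addn0 in in1.
  rewrite -addnA (addnC _ N) addnA in2 // in1 ?add0n ?leq_addr // in ev.
  split.
  - by have -> : (h + d.+1 * (w + w) = h + d * (w + w) + (w + w))%N
      by rewrite mulSn; lia.
  - by rewrite el3.
  - move=> q; rewrite ltnS leq_eqVlt => /orP[/eqP->|ltq].
      rewrite ev; apply: merge_sorted; first exact: leE_total.
        have -> : (h + d * (w + w) = h + (d + d) * w)%N by lia.
        by apply: srt; lia.
      have -> : (h + d * (w + w) + w = h + (d + d).+1 * w)%N by lia.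
      by apply: srt; lia.
    rewrite (eq_arr (s := s3) (s' := s2)) ?sr // => a ina; apply: fc3.
    by have := leq_mul2r (w + w) q.+1 d; rewrite ltq orbT mulSn; lia.
  - have -> : (d.+1 * (w + w) = d * (w + w) + (w + w))%N by rewrite mulSn addnC.
    rewrite !(arrD _ _ (d * (w + w))) perm_cat //.
      rewrite (eq_arr (s := s3) (s' := s2)) // => a ina; apply: fc3; lia.
    by rewrite ev arrD perm_merge.
  - by move=> a lta; rewrite fc3 ?fc //; lia.
move=> s2 [d]; rewrite addn0 => -> [[e1 ez eN ew eh] el sr pm fc].
apply: triple_block; first by [].
by rewrite -EN in eh pm; split=> //; split; rewrite /= /upd /= ?ew.
Qed.

(** After [d] passes the sorted runs have length [2 ^ d], starting from trivially sorted single
    cells. The array moves at each pass, so its final position [h'] is left existential. *)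
Lemma triple_merge_sort s k h : sort_regs s (2 ^ k) 1 h ->
  triple merge_sort s (k * (26 * 2 ^ k).+2).+2 (fun s' => exists h',
    [/\ ireg s' r1 = 1%N, ireg s' rz = 0%N, ireg s' rN = (2 ^ k)%N,
        ireg s' rh = h' & sorted leE (arr s' h' (2 ^ k)) /\
        perm_eq (arr s' h' (2 ^ k)) (arr s h (2 ^ k))]).
Proof.
move=> rs.
pose I m s' := exists b, exists2 d, (d + m = k)%N &
  [/\ sort_regs s' (2 ^ k) (2 ^ d) b, runs_sorted s' b (2 ^ d) (2 ^ m) &
      perm_eq (arr s' b (2 ^ k)) (arr s h (2 ^ k))].
have Ik : I k s.
  by exists h, 0%N => //; split.
have H m s' : I m s' -> holds (TestI rw rN) s' = (0 < m)%N.
  by case=> b [d <- [[_ _ /= -> -> _] _ _]]; rewrite ltn_exp2l //; lia.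
have := triple_while H _ Ik => /(_ merge_pass (26 * 2 ^ k)%N) H'.
apply: triple_weaken (H' _) (leqnn _) _ => [m s'|s'].
  case=> b [d edm [rs' sr pm]].
  apply: triple_weaken (triple_merge_pass (m := (2 ^ m).-1) rs' _ _ _) _ _ => //.
  - by rewrite expn_gt0.
  - by rewrite prednK ?expn_gt0 // -edm expnD expnS; nia.
  - by rewrite prednK ?expn_gt0 // addnn -mul2n -expnS.
  move=> s2 [rs2 sr2 pm2]; exists (b + 2 ^ k)%N, d.+1; first by lia.
  split; last exact: perm_trans pm.
    by rewrite expnS mul2n -addnn.
  by move: sr2; rewrite prednK ?expn_gt0 // expnS mul2n -addnn.
case=> b [d]; rewrite addn0 => -> [[e1 ez eN ew eh] sr pm].
exists b; split=> //; split=> //.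
by have := sr 0%N; rewrite mul0n addn0; apply.
Qed.

(** * The algorithm *)

(** Doubling finds the least power of two that is at least [2 * n], which bounds the number of
    events; these start right after the input. With [ri = 2 * d], the limit [2 * n - 4] encodes
    [d + 2 < n], and truncated subtraction makes the loop empty when [n <= 2]. *)
Definition init_size : cmd :=
  Seq (Block [:: IConst r1 1; IConst rN 1; IAdd rlim rn rn])
  (Seq (While (TestI rN rlim) (Block [:: IAdd rN rN rN]))
  (Block [:: IAdd rh rlim rz; IAdd rk rlim rz; IConst rt 4; ISub rlim rlim rt;
             IConst ri 0; IConst ru 2])).

Definition load_vertex (c : nat) : cmd :=
  Block [:: FLoad c rj; IAdd rj rj r1; FLoad c.+1 rj; IAdd rj rj r1].

(** Real registers 0 to 5 receive three consecutive vertices; 6 and 8 end up with the slopes of the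
    edges before and after the middle one. The constant 2 in [ru] is both the stride of [ri] and the
    closing tag. *)
Definition event_step : cmd :=
  Seq (Block [:: IAdd rj ri rz; IAdd ri ri ru])
  (Seq (load_vertex 0) (Seq (load_vertex 2) (Seq (load_vertex 4)
  (Seq (Block [:: FArith OpSub 6 3 1; FArith OpSub 7 2 0; FArith OpDiv 6 6 7])
  (Seq (Block [:: FArith OpSub 8 5 3; FArith OpSub 9 4 2; FArith OpDiv 8 8 9])
  (If (TestF 8 6)
    (Block [:: FStore rk 8; IStore rk r1; IAdd rk rk r1;
               FStore rk 6; IStore rk ru; IAdd rk rk r1])
    (Block [::]))))))).

Definition store_events : cmd := While (TestI ri rlim) event_step.

(** For a tag [t], [ru] is [t - 1], and [rup] grows by [t - 2 * (t - 1)], which is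
    1 if [t = 1] and 0 if [t] is 0 or 2. *)
Definition sweep_step : cmd :=
  Seq (Block [:: ILoad rt ri; ISub ru rt r1; IAdd rdn rdn ru; IAdd rup rup rt])
  (Seq (Block [:: ISub rup rup ru; ISub rup rup ru; FLoad 0 ri; FLoad 1 rj])
  (Seq (Block [:: IAdd ri ri r1; IAdd rj rj r1])
  (If (TestF 0 1)
    (Block [:: ISub rt rup rdn; ISub rt rt rn; IAdd rn rn rt])
    (Block [::])))).

Definition sweep : cmd :=
  Seq (Block [:: IConst rn 0; IAdd ri rh rz; IAdd rj ri r1; IAdd rlim rh rN;
                 IConst rup 0; IConst rdn 0])
  (While (TestI rj rlim) sweep_step).

Definition prickliness_cmd : cmd :=
  Seq init_size (Seq store_events
  (Seq (Block [:: IConst rw 1]) (Seq merge_sort sweep))).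

Lemma triple_init_size s n : ireg s rn = n -> ireg s rz = 0%N ->
  triple init_size s (11 + 3 * up_log 2 (n + n)) (fun s' =>
    [/\ [/\ ireg s' r1 = 1, ireg s' rz = 0, ireg s' rN = 2 ^ up_log 2 (n + n) &
            ireg s' rh = n + n]%N,
        [/\ ireg s' rk = n + n, ireg s' rlim = n + n - 4, ireg s' ri = 0 &
            ireg s' ru = 2]%N &
        forall a, cell s' a = cell s a]).
Proof.
move=> en ez; set k := up_log _ _.
pose I m s' := exists2 d, (d + m = k)%N &
  [/\ ireg s' r1 = 1, ireg s' rz = 0, ireg s' rN = 2 ^ d &
      ireg s' rlim = n + n]%N /\ (forall a, cell s' a = cell s a).
apply: triple_weaken (_ : (3 + ((k * 3).+2 + 6) <= _)%N) (fun s' H => H);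
  last by lia.
apply: (@triple_seq _ _ _ _ 3 _ (I k)).
  apply: triple_block; first by [].
  by exists 0%N => //; rewrite /= /upd /= ez en.
move=> s1 Is1; apply: (@triple_seq _ _ _ _ _ _ (I 0%N)).
  apply: triple_while Is1 => m s2 [d edm [[e1 ez2 eN el] ec]].
    rewrite /= eN el; have [m0|m0] := posnP m.
      apply/negbTE; rewrite -leqNgt (_ : d = k); last by lia.
      exact: up_logP.
    rewrite ltnNge; apply/negP => /(up_log_min (isT : 1 < 2)%N); rewrite -/k; lia.
  apply: triple_block; first by [].
  exists d.+1; first by lia.
  by rewrite /= /upd /= e1 ez2 eN el expnS mul2n addnn.
move=> s2 [d]; rewrite addn0 => -> [[e1 ez2 eN el] ec].
apply: triple_block; first by [].
by rewrite /= /upd /= ez2 el addn0.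
Qed.

Lemma arr_fresh s a l1 l2 : (l1 <= l2)%N ->
  (forall b, (a + l1 <= b)%N -> cell s b = (0, 0%N)) ->
  arr s a l2 = arr s a l1 ++ nseq (l2 - l1) (0, 0%N).
Proof.
move=> le12 fr; rewrite -{1}(subnKC le12) arrD; congr cat.
elim: (l2 - l1)%N (a + l1)%N fr => //= m IH b fr.
by rewrite arr_cons fr // IH // => c lec; apply: fr; exact: ltnW.
Qed.

(** * Computing and storing the endpoint events *)

Section Events.
Variables (n : nat) (T : n.-tuple (R * R)).
Hypothesis terT : terrain T.

Lemma size_flatten_events l :
  (size (flatten [seq vertex_events T i | i <- l]) <= size l + size l)%N.
Proof.
elim: l => //= i l IH; rewrite size_cat /vertex_events.
by case: ifP => _ /=; rewrite addSn addnS ?ltnS ?add0n // (leq_trans IH) // leqW.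
Qed.

(** The blank cells beyond the events become the padding of the array to be sorted; the last clause
    keeps the coordinates readable. *)
Definition stored (N d : nat) s : Prop :=
  let E := flatten [seq vertex_events T i | i <- iota 1 d] in
  [/\ [/\ ireg s r1 = 1, ireg s rz = 0, ireg s rN = N & ireg s rh = n + n]%N,
      [/\ ireg s rk = n + n + size E, ireg s rlim = n + n - 4,
          ireg s ri = d + d & ireg s ru = 2]%N,
      arr s (n + n) (size E) = E,
      (forall a, (n + n + size E <= a)%N -> cell s a = (0, 0%N)) &
      forall a, (a < n + n)%N -> fmem s a = fmem (input T) a].

Definition inputs_kept s : Prop :=
  forall a, (a < n + n)%N -> fmem s a = fmem (input T) a.

Lemma triple_load_vertex c i s : c \in [:: 0; 2; 4]%N -> (i < n)%N ->
  ireg s r1 = 1%N -> ireg s rj = (i + i)%N -> inputs_kept s ->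
  triple (load_vertex c) s 4 (fun s' =>
   [/\ (freg s' c, freg s' c.+1) = nth (0, 0) T i,
     ireg s' rj = (i.+1 + i.+1)%N,
     (forall r, r \notin [:: c; c.+1] -> freg s' r = freg s r),
     (forall r, r != rj -> ireg s' r = ireg s r) &
     forall a, cell s' a = cell s a]).
Proof.
move=> c024 lti e1 ej fin; apply: triple_block; first by [].
split; last by [].
- rewrite /= /upd /= ej e1 addn1 !fin /= ?addnn ?odd_double ?uphalf_double; try lia.
  rewrite doubleK; move: c024; rewrite !inE.
  by case/or3P=> /eqP-> /=; rewrite -surjective_pairing.
- by rewrite /= /upd /= ej e1 !addn1 addSn addnS.
- by move=> r; rewrite !inE negb_or => /andP[/negbTE n1 /negbTE n2]; rewrite /= /upd n1 n2.
- by move=> r /negbTE nr; rewrite /= /upd nr.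
Qed.

(** In continuation form: the final conditional is left to the caller, who distinguishes descents of
    slope from the other vertices. *)
Lemma triple_slopes N d s : (d + 2 < n)%N -> stored N d s -> forall T2 Q,
  (forall s', [/\ freg s' 6 = slope T d, freg s' 8 = slope T d.+1,
      ireg s' ri = (d.+1 + d.+1)%N,
      (forall r, r \notin [:: ri; rj] -> ireg s' r = ireg s r) &
      forall a, cell s' a = cell s a] -> triple (If (TestF 8 6)
    (Block [:: FStore rk 8; IStore rk r1; IAdd rk rk r1;
               FStore rk 6; IStore rk ru; IAdd rk rk r1])
    (Block [::])) s' T2 Q) ->
  triple event_step s (2 + (4 + (4 + (4 + (3 + (3 + T2)))))) Q.
Proof.
move=> ltd [[e1 ez eN eh] [ek el ei eu] ev fr fin] T2 Q H.
(* Strictly increasing abscissae make both divisions defined. *)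
have dx i : (i.+1 < n)%N ->
    ((nth (0, 0) T i.+1).1 - (nth (0, 0) T i).1 == 0) = false.
  move=> lti; rewrite gt_eqF // subr_gt0.
  have := terT (i := Ordinal (ltnW lti)) (j := Ordinal lti) (ltnSn i).
  by rewrite !(tnth_nth (0, 0)).
have [lt0 lt1 lt2] : [/\ d < n, d.+1 < n & d.+2 < n]%N by split; lia.
have keep s' : (forall a, cell s' a = cell s a) -> inputs_kept s'.
  by move=> ec a lta; have [-> _] := ec a; apply: fin.
apply: (@triple_seq _ _ _ _ _ _ (fun s' => [/\ ireg s' rj = (d + d)%N,
    ireg s' ri = (d.+1 + d.+1)%N,
    (forall r, r \notin [:: ri; rj] -> ireg s' r = ireg s r) &
    forall a, cell s' a = cell s a])).
  apply: triple_block; first by [].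
  split=> //; rewrite /= /upd /= ?ei ?ez ?eu ?addn0 //; first by lia.
  by move=> r; rewrite !inE negb_or => /andP[/negbTE-> /negbTE->].
move=> s1 [j1 i1 r_1 c1]; apply: triple_seq.
  by apply: triple_load_vertex lt0 _ j1 (keep _ c1); rewrite ?r_1.
move=> s2 [x2 j2 f2 r_2 c2].
have c2' a : cell s2 a = cell s a by rewrite c2.
apply: triple_seq.
  by apply: triple_load_vertex lt1 _ j2 (keep _ c2'); rewrite ?r_2 ?r_1.
move=> s3 [x3 j3 f3 r_3 c3].
have c3' a : cell s3 a = cell s a by rewrite c3.
apply: triple_seq.
  by apply: triple_load_vertex lt2 _ j3 (keep _ c3'); rewrite ?r_3 ?r_2 ?r_1.
move=> s4 [x4 j4 f4 r_4 c4].
have {}dx0 := dx _ lt1; have {}dx1 := dx _ lt2.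
rewrite /slope in H; rewrite -x2 -x3 -x4 /= in H dx0 dx1.
have fr4 r : r \notin [:: ri; rj] -> ireg s4 r = ireg s r.
  move=> nr; move: (nr); rewrite !inE negb_or => /andP[_ nj].
  by rewrite r_4 // r_3 // r_2 // r_1.
have c4' a : cell s4 a = cell s a by rewrite c4.
pose s5 := set_freg (set_freg (set_freg s4 6 (freg s3 3 - freg s2 1)) 7
  (freg s3 2 - freg s2 0)) 6
  ((freg s3 3 - freg s2 1) / (freg s3 2 - freg s2 0)).
apply: (@triple_seq _ _ _ _ _ _ (fun s' => s' = s5)).
  apply: triple_block; last by [].
  rewrite /= /upd /= !(f4 3, f4 2, f4 1, f4 0, f3 1, f3 0) //.
  by rewrite dx0.
move=> _ ->.
pose s6 := set_freg (set_freg (set_freg s5 8 (freg s4 5 - freg s3 3)) 9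
  (freg s4 4 - freg s3 2)) 8
  ((freg s4 5 - freg s3 3) / (freg s4 4 - freg s3 2)).
apply: (@triple_seq _ _ _ _ _ _ (fun s' => s' = s6)).
  apply: triple_block; last by [].
  rewrite /= /upd /= !(f4 3, f4 2) //.
  by rewrite dx1.
move=> _ ->; apply: H; split=> //=.
by rewrite r_4 // r_3 // r_2.
Qed.

Lemma triple_event_step N d s : (d + 2 < n)%N -> stored N d s ->
  triple event_step s 28 (stored N d.+1).
Proof.
move=> ltd sN; apply: (triple_slopes (T2 := 8) ltd sN).
case: sN => [[e1 ez eN eh] [ek el ei eu] ev fr fin].
set E := flatten _ in ek ev fr.
move=> s1 [f6 f8 i1 fr1 fc1].
have eE : flatten [seq vertex_events T i | i <- iota 1 d.+1]
    = E ++ vertex_events T d.+1.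
  by rewrite -[in LHS](addn1 d) iotaD map_cat flatten_cat /= cats0 add1n.
have cl m l : arr s1 m l = arr s m l by apply: eq_arr.
have fm a : fmem s1 a = fmem s a by have [] := fc1 a.
apply: (@triple_if _ _ _ _ _ 6); rewrite /= f6 f8 => lt.
  set K := (n + n + size E)%N in ek fr.
  apply: (@triple_weaken _ _ _ 6 6 (fun s2 => [/\ ireg s2 rk = K.+2,
    (forall r, r != rk -> ireg s2 r = ireg s1 r) &
    forall a, cell s2 a = if a == K.+1 then (slope T d, 2%N) else
      if a == K then (slope T d.+1, 1%N) else cell s a])); last first.
  - move=> s2 [k2 fr2 fc2].
    have vE : vertex_events T d.+1 = [:: (slope T d.+1, 1%N); (slope T d, 2%N)].
      by rewrite /vertex_events lt.
    have sE : (n + n + (size E + 2) = K.+2)%N by rewrite addn2 !addnS.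
    rewrite /stored eE vE size_cat /= sE; split.
    + by rewrite !fr2 // !fr1.
    + by rewrite k2 !fr2 // i1 !fr1.
    + rewrite arrD /= -/K; congr (_ ++ _); last first.
        by rewrite /arr /= !fc2 !eqxx (ltn_eqF (ltnSn K)).
      rewrite -[RHS]ev; apply: eq_arr => a /andP[_ lta].
      by rewrite fc2 !ltn_eqF // ltnW.
    + by move=> a lea; rewrite fc2 !gtn_eqF ?fr //; lia.
    + move=> a lta; have [] : cell s2 a = cell s a; last by move=> -> _; exact: fin.
      by rewrite fc2 !ltn_eqF // /K; lia.
  - by [].
  apply: triple_block; first by [].
  have k1 : ireg s1 rk = K by rewrite fr1.
  split.
  - by rewrite /= /upd /= k1 !fr1 // e1 !addn1.
  - by move=> r /negbTE nr; rewrite /= /upd nr.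
  - move=> a; rewrite /cell /= /upd /= k1 !fr1 // e1 eu addn1 f6 f8.
    have [-> ->] := fc1 a; case: (a == K.+1) => //.
    by case: (a == K).
apply: (@triple_weaken _ _ _ 0 6 (stored N d.+1)) => //.
apply: triple_block; first by [].
have vE : vertex_events T d.+1 = [::] by rewrite /vertex_events (negbTE lt).
rewrite /stored eE vE cats0; split.
- by rewrite !fr1.
- by rewrite i1 !fr1.
- by rewrite cl.
- by move=> a lea; rewrite fc1 fr.
- by move=> a lta; rewrite fm fin.
Qed.

Lemma triple_store_events N s : (n + n <= N)%N -> stored N 0 s ->
  triple store_events s (2 + 30 * (n - 2)) (fun s' =>
    [/\ [/\ ireg s' r1 = 1, ireg s' rz = 0, ireg s' rN = N & ireg s' rh = n + n]%N &
      arr s' (n + n) N = events T ++ nseq (N - size (events T)) (0, 0%N)]).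
Proof.
move=> leN s0; pose I m s' := exists2 d, (d + m = n - 2)%N & stored N d s'.
apply: (@triple_weaken _ _ _ ((n - 2) * 28.+2).+2 _ (I 0%N)); last first.
- move=> s' [d]; rewrite addn0 => -> [rs _ ev fr _]; split=> //.
  have le : (size (events T) <= N)%N.
    have := size_flatten_events (iota 1 (n - 2)); rewrite size_iota => le.
    by apply: leq_trans le _; apply: leq_trans leN; rewrite leq_add ?leq_subr.
  by rewrite (arr_fresh le fr) ev.
- by lia.
apply: triple_while; last by exists 0%N.
- by move=> m s' [d edm [_ [_ el ei _] _ _ _]]; rewrite /= ei el; lia.
move=> m s' [d edm sN].
apply: triple_weaken (triple_event_step _ sN) _ _ => //; first by lia.
by move=> s2 sN2; exists d.+1; first by lia.
Qed.

End Events.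

(** * Sweeping the sorted events *)

Definition swept xs N h m s : Prop := exists2 d, (d + m = N.-1)%N &
  [/\ [/\ ireg s r1 = 1, ireg s rj = h + d.+1, ireg s ri = h + d &
          ireg s rlim = h + N]%N,
      [/\ ireg s rup = count (has_tag 1) (take d xs),
          ireg s rdn = count (has_tag 2) (take d xs) &
          ireg s rn = (\max_(0 <= e < d) sweep_depth xs e)%N] &
      arr s h N = xs].

(** For tags up to 2, truncated subtraction yields indicators: [t - 1] of a closing tag and
    [t - 2 * (t - 1)] of an opening one. *)
Lemma triple_sweep_step xs N h m s : all (fun e : R * nat => (e.2 <= 2)%N) xs ->
  swept xs N h m.+1 s -> triple sweep_step s 15 (swept xs N h m).
Proof.
move=> tags [d edm [[e1 ej ei el] [eup edn en] ev]].
have sz : size xs = N by rewrite -ev size_arr.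
have ltd : (d.+1 < N)%N by lia.
have cd : cell s (h + d) = nth (0, 0%N) xs d by rewrite -ev nth_arr //; lia.
have cd1 : cell s (h + d.+1) = nth (0, 0%N) xs d.+1 by rewrite -ev nth_arr.
have tk : take d.+1 xs = rcons (take d xs) (nth (0, 0%N) xs d).
  by rewrite (take_nth (0, 0%N)) // sz; lia.
have ltag : ((nth (0%R, 0) xs d).2 <= 2)%N.
  by apply: (all_nthP (0, 0%N) tags); rewrite sz; lia.
pose w := imem s (h + d)%N.
pose s1 := set_ireg (set_ireg (set_ireg (set_ireg s rt w) ru (w - 1)%N)
  rdn (ireg s rdn + (w - 1))%N) rup (ireg s rup + w)%N.
apply: (@triple_seq _ _ _ _ 4 11 (fun s' => s' = s1)).
  by apply: triple_block; last by []; rewrite /= /upd /= ei e1.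
move=> _ ->.
pose s2 := set_freg (set_freg (set_ireg
  (set_ireg s1 rup (ireg s rup + w - (w - 1))%N)
    rup (ireg s rup + w - (w - 1) - (w - 1))%N)
  0 (nth (0, 0%N) xs d).1) 1 (nth (0, 0%N) xs d.+1).1.
apply: (@triple_seq _ _ _ _ 4 7 (fun s' => s' = s2)).
  apply: triple_block; last by [].
  by rewrite /= /upd /= ei ej /s2 -cd -cd1.
move=> _ ->.
apply: (@triple_seq _ _ _ _ 2 5 (fun s' =>
  [/\ [/\ ireg s' r1 = 1, ireg s' rj = h + d.+2, ireg s' ri = h + d.+1 &
          ireg s' rlim = h + N]%N,
      [/\ ireg s' rup = count (has_tag 1) (take d.+1 xs),
          ireg s' rdn = count (has_tag 2) (take d.+1 xs) &
          ireg s' rn = (\max_(0 <= e < d) sweep_depth xs e)%N],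
      freg s' 0 = (nth (0, 0%N) xs d).1,
      freg s' 1 = (nth (0, 0%N) xs d.+1).1 & arr s' h N = xs])).
  apply: triple_block; first by [].
  rewrite tk -!cats1 !count_cat; split.
  - by split; rewrite /= /upd /= ?e1 ?ej ?ei ?el //; lia.
  - rewrite /= /upd /= eup edn en /has_tag /w -cd /=; move: ltag; rewrite -cd /=.
    by case: (imem s (h + d)) => [|[|[|]]] // _; split=> //; lia.
  - by [].
  - by [].
  - by rewrite -[RHS]ev.
move=> s3 [[a1 aj ai al] [aup adn an] f0 f1 av].
have bE : (\max_(0 <= e < d.+1) sweep_depth xs e)%N =
    maxn (\max_(0 <= e < d) sweep_depth xs e)%N (sweep_depth xs d).
  by rewrite big_nat_recr.
apply: (@triple_if _ _ _ _ _ 3); rewrite /= f0 f1 => lt.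
  apply: triple_block; first by [].
  exists d.+1; first by lia.
  split=> //; split=> //; rewrite /= /upd /= bE /sweep_depth lt an aup adn.
  (* With truncated subtraction, adding [x - rn] to [rn] gives the maximum of [rn] and [x]. *)
  by rewrite maxnE.
apply: (@triple_weaken _ _ _ 0 3 (swept xs N h m)) => //.
apply: triple_block; first by [].
exists d.+1; first by lia.
by split=> //; split=> //; rewrite bE /sweep_depth (negbTE lt) maxn0.
Qed.

Lemma triple_sweep xs N h s : (0 < N)%N ->
  all (fun e : R * nat => (e.2 <= 2)%N) xs ->
  ireg s r1 = 1%N -> ireg s rz = 0%N -> ireg s rN = N -> ireg s rh = h ->
  arr s h N = xs ->
  triple sweep s (8 + 17 * N) (fun s' =>
    ireg s' rn = (\max_(0 <= e < N.-1) sweep_depth xs e)%N).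
Proof.
move=> N0 tags e1 ez eN eh ev.
apply: triple_weaken (_ : (6 + (N.-1 * 15.+2).+2 <= _)%N) (fun s' H => H);
  last by lia.
apply: (@triple_seq _ _ _ _ 6 _ (swept xs N h N.-1)).
  apply: triple_block; first by [].
  exists 0%N => //; rewrite take0 big_geq //.
  by split=> //; split; rewrite /= /upd /= ?e1 ?ez ?eN ?eh //; lia.
move=> s1 sw; apply: triple_weaken (triple_while _ _ sw) (leqnn _) _.
- move=> m s2 [d edm [[_ ej _ el] _ _]]; rewrite /= ej el; lia.
- by move=> m s2; apply: triple_sweep_step.
by move=> s2 [d]; rewrite addn0 => -> [_ [_ _ ->] _].
Qed.

Lemma events_tags n (T : n.-tuple (R * R)) k :
  all (fun e : R * nat => (e.2 <= 2)%N) (events T ++ nseq k (0, 0%N)).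
Proof.
rewrite all_cat; apply/andP; split; last by apply/allP => e /nseqP[->].
apply/allP => e /flattenP[_ /mapP[i _ ->]]; rewrite /vertex_events.
by case: ifP => // _; rewrite !inE => /orP[]/eqP->.
Qed.

Lemma triple_prickliness n (T : n.-tuple (R * R)) : terrain T ->
  let k := up_log 2 (n + n) in
  triple prickliness_cmd (input T) (100 * (2 ^ k * k.+1))
    (fun s => ireg s rn = prickliness T).
Proof.
move=> terT k; set N := (2 ^ k)%N.
have leN : (n + n <= N)%N by apply: up_logP.
have N0 : (0 < N)%N by rewrite expn_gt0.
(* The [k] merge passes dominate; [n + n <= N] and [0 < N] absorb the other terms into the generous
   constant 100. *)
apply: (@triple_weaken _ _ _ (11 + 3 * k + (2 + 30 * (n - 2) +
  (1 + ((k * (26 * N).+2).+2 + (8 + 17 * N))))) _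
  (fun s => ireg s rn = prickliness T)) => //; last by nia.
apply: triple_seq; first by apply: triple_init_size; by [].
move=> s1 [[e1 ez eN eh] [ek el ei eu] ec].
apply: triple_seq.
  apply: (triple_store_events terT leN); split=> //=.
  - by rewrite addn0.
  (* The default vertex [(0, 0)] of [input] makes every cell from [n + n] on blank. *)
  - move=> a; rewrite addn0 ec /cell /= => lea; rewrite nth_default /=; last first.
      by rewrite size_tuple; lia.
    by rewrite if_same.
  - by move=> a _; have [] := ec a.
move=> s2 [[{}e1 {}ez {}eN {}eh] ev].
apply: (@triple_seq _ _ _ _ 1 _ (fun s => sort_regs s N 1 (n + n) /\
  arr s (n + n) N = arr s2 (n + n) N)).
  by apply: triple_block; first by [].
move=> s3 [rs ev3]; apply: triple_seq; first exact: triple_merge_sort rs.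
move=> s4 [h [{}e1 {}ez {}eN {}eh [srt pm]]].
rewrite ev3 ev in pm.
have tags : all (fun e : R * nat => (e.2 <= 2)%N) (arr s4 h N).
  by rewrite (perm_all _ pm) events_tags.
apply: triple_weaken (triple_sweep N0 tags e1 ez eN eh erefl) (leqnn _) _.
by move=> s5 ->; rewrite -(sweep_prickliness terT srt pm) size_arr.
Qed.

End Memory.

(** * The complete program and its asymptotic running time *)

Definition prickliness_program : program := compile 0 prickliness_cmd.

Lemma prickliness_programP (R : realType) n (T : n.-tuple (R * R)) :
  terrain T -> exists t s, let k := up_log 2 (n + n) in
  [/\ halts_in prickliness_program (input T) t s,
      (t <= 100 * (2 ^ k * k.+1))%N & output s = prickliness T].
Proof.
move=> /triple_prickliness /(_ prickliness_program 0%N) [] // t [s [st le out]].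
(* The run stops just past the last instruction, where [nth] returns its default [Halt]. *)
by exists t, (goto s (size prickliness_program)); split=> //; split=> //.
Qed.

(** Minimality of [k] gives [2 ^ k <= 4 * n], which is at most [n ^ 2] once [n >= 4]; so
    [k * ln 2 <= 2 * ln n], while [k.+1 <= 2 * k]. *)
Lemma time_bigO (R : realType) (c : nat) :
  (fun n => (c * (2 ^ up_log 2 (n + n) * (up_log 2 (n + n)).+1))%:R : R)
    =O_\oo (fun n => n%:R * ln n%:R : R).
Proof.
have ln2 : 0 < ln 2 :> R by apply: ln_gt0; rewrite ltr1n.
(* The factor 16 is [4 * 2 * 2] from the three estimates; the successor keeps the constant positive
   when [c = 0]. *)
apply/eqO_exP; exists ((c * 16).+1%:R / ln 2); first by rewrite divr_gt0 ?ltr0n.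
exists 4%N => // n /= len; set k := up_log _ _.
have n0 : 0 < n%:R :> R by rewrite ltr0n; lia.
have k0 : (0 < k)%N by rewrite /k up_log_gt0; lia.
have le4n : (2 ^ k <= 4 * n)%N.
  have := @up_log_gtn 2 (n + n) isT; rewrite -/k => H.
  by rewrite -(prednK k0) expnS; have := H ltac:(lia); lia.
have lek : k%:R * ln 2 <= 2 * ln n%:R :> R.
  have -> : k%:R * ln 2 = ln (2 ^+ k) :> R by rewrite lnXn // mulr_natl.
  have -> : 2 * ln n%:R = ln (n%:R ^+ 2) :> R by rewrite lnXn // mulr_natl.
  rewrite ler_ln ?posrE ?exprn_gt0 // -!natrX ler_nat.
  by apply: leq_trans le4n _; rewrite expnS expn1 leq_mul2r len orbT.
have lnn : 0 <= ln n%:R :> R by apply: ln_ge0; rewrite ler1n; lia.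
rewrite !ger0_norm ?mulr_ge0 ?ler0n //.
apply: (@le_trans _ _ ((c * ((4 * n) * (2 * k)))%:R)).
  by rewrite ler_nat leq_mul2l leq_mul ?orbT //; lia.
rewrite mulrAC ler_pdivlMr // !natrM.
have -> : c%:R * (4 * n%:R * (2 * k%:R)) * ln 2
  = (c%:R * 8 * n%:R) * (k%:R * ln 2) :> R by ring.
apply: le_trans (ler_wpM2l _ lek) _; first by rewrite !mulr_ge0 ?ler0n.
rewrite -[(c * 16).+1]addn1 natrD natrM.
have -> : (c%:R * 16 + 1) * (n%:R * ln n%:R)
  = c%:R * 8 * n%:R * (2 * ln n%:R) + n%:R * ln n%:R :> R by ring.
by rewrite lerDl mulr_ge0 // ltW.
Qed.

Theorem theorem6 (R : realType) :
  exists (P : program) (time : nat -> nat),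
    (forall (n : nat) (T : n.-tuple (R * R)), terrain T ->
       exists (t : nat) (s : state R),
         [/\ halts_in P (input T) t s, (t <= time n)%N
           & output s = prickliness T]) /\
    (fun n => (time n)%:R : R) =O_\oo (fun n => n%:R * ln n%:R : R).
Proof.
exists prickliness_program.
exists (fun n => 100 * (2 ^ up_log 2 (n + n) * (up_log 2 (n + n)).+1))%N.
split; [exact: prickliness_programP|exact: time_bigO].
Qed.
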